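(* Assume that $g:\mathbb{R}^d\to\mathbb{R}$ is $L_g$-Lipschitz continuous, i.e. $|g(z)-g(z')|\le L_g\|z-z'\|$ for all $z,z'\in\mathbb{R}^d$. For any $x_1\in\mathcal{X}$ and $\beta_0>0$, every sequence $(x_k)$ generated by the composite conditional gradient algorithm described in the context satisfies, for every integer $k\ge 2$, $$F(x_k)-F^\star \;\le\; 2D_{\mathcal{X}}^2\left(\frac{L_f}{k}+\frac{\|A\|^2}{\beta_0\sqrt{k}}\right)+\frac{\beta_0L_g^2}{2\sqrt{k}}.$$ Furthermore, if $\beta_0=2D_{\mathcal{X}}\|A\|/L_g$ is chosen (when this is a well-defined positive number), then for every integer $k\ge 2$, $$F(x_k)-F^\star\;\le\;\frac{2D_{\mathcal{X}}^2L_f}{k}+\frac{2D_{\mathcal{X}}\|A\|L_g}{\sqrt{k}}.$$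
   Context: Problem: $\min_{x\in\mathcal{X}} F(x) := f(x)+g(Ax)$, where $\mathcal{X}\subset\mathbb{R}^n$ is nonempty, compact and convex; $f$ is a proper closed convex function that is real-valued and differentiable on $\mathcal{X}$ and $L_f$-smooth, i.e. $\|\nabla f(x)-\nabla f(x')\|\le L_f\|x-x'\|$ for all $x,x'\in\mathcal{X}$; $A\in\mathbb{R}^{d\times n}$; and $g$ is a closed convex function on $\mathbb{R}^d$ (possibly non-smooth). Norms of vectors are Euclidean, and $\|A\|$ is the spectral norm. The set of minimizers is assumed nonempty; $x^\star$ is a minimizer and $F^\star=F(x^\star)$. $D_{\mathcal{X}}=\max_{x,x'\in\mathcal{X}}\|x-x'\|$. Also $\mathrm{prox}_{\phi}(v)=\arg\min_x \phi(x)+\frac12\|x-v\|^2$. Algorithm: given $x_1\in\mathcal{X}$, $\beta_0>0$, for $k=1,2,\dots$ set $\eta_k=\frac{2}{k+1}$, $\beta_k=\frac{\beta_0}{\sqrt{k+1}}$, $v_k=\beta_k\nabla f(x_k)+A^\top\big(Ax_k-\mathrm{prox}_{\beta_k g}(Ax_k)\big)$, choose $s_k\in\arg\min_{x\in\mathcal{X}}\langle v_k,x\rangle$, and set $x_{k+1}=x_k+\eta_k(s_k-x_k)$. *)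

(* Defs.v *)
From HB Require Import structures.
From mathcomp Require Import all_boot all_order all_algebra.
From mathcomp Require Import all_classical all_reals all_analysis.
Import Order.TTheory GRing.Theory Num.Theory.
Import numFieldNormedType.Exports.

Set Implicit Arguments.
Unset Strict Implicit.
Unset Printing Implicit Defensive.

Local Open Scope classical_set_scope.
Local Open Scope ring_scope.

Definition dotv (R : realType) (n : nat) (u v : 'cV[R]_n) : R :=
  \sum_i u i 0 * v i 0.

(* Not the library norm `|x| on matrices, which is the sup norm; both norms
   induce the same topology and the same notion of differentiability. *)
Definition enorm (R : realType) (n : nat) (x : 'cV[R]_n) : R :=
  Num.sqrt (dotv x x).

Definition spectral_norm (R : realType) (d n : nat) (A : 'M[R]_(d, n)) : R :=
  sup [set enorm (A *m x) | x in [set x : 'cV[R]_n | enorm x <= 1]].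

(* The supremum is attained when X is nonempty and compact. *)
Definition diameter (R : realType) (n : nat) (X : set 'cV[R]_n) : R :=
  sup [set enorm (x - y) | x in X & y in X].

Definition argmin (disp : Order.disp_t) (U : porderType disp) (T : Type)
    (S : set T) (phi : T -> U) : set T :=
  [set x | S x /\ forall y, S y -> (phi x <= phi y)%O].

(* For phi closed and convex the argmin is a singleton, so that [get] returns
   its unique element. *)
Definition prox (R : realType) (d : nat) (phi : 'cV[R]_d -> R)
    (v : 'cV[R]_d) : 'cV[R]_d :=
  get (argmin setT (fun z => phi z + 2^-1 * enorm (z - v) ^+ 2)).

Definition epigraph (R : realType) (n : nat) (f : 'cV[R]_n -> \bar R) :
    set ('cV[R]_n * R^o) :=
  [set p | (f p.1 <= p.2%:E)%E].

Definition proper_fun (R : realType) (n : nat) (f : 'cV[R]_n -> \bar R) : Prop :=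
  (forall x, f x != -oo%E) /\ (exists x, f x != +oo%E).

Definition closed_convex (R : realType) (n : nat) (f : 'cV[R]_n -> \bar R) : Prop :=
  closed (epigraph f) /\ convex_set (epigraph f).

(* An extended-real-valued function is differentiable at x when it is finite
   on a neighbourhood of x and its real restriction there is differentiable;
   the neighbourhood clause is needed since [fine] maps +oo to 0. *)
Definition ediff (R : realType) (n : nat) (f : 'cV[R]_n -> \bar R)
    (x : 'cV[R]_n) : Prop :=
  (\forall y \near x, f y \is a fin_num) /\
  differentiable (fine \o f : 'cV[R]_n -> R^o) x.

Definition grad (R : realType) (n : nat) (f : 'cV[R]_n -> \bar R)
    (x : 'cV[R]_n) : 'cV[R]_n :=
  \col_i 'D_(delta_mx i 0) (fine \o f : 'cV[R]_n -> R^o) x.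

Definition smooth_on (R : realType) (n : nat) (X : set 'cV[R]_n)
    (f : 'cV[R]_n -> \bar R) (L : R) : Prop :=
  forall x y, X x -> X y -> enorm (grad f x - grad f y) <= L * enorm (x - y).

Definition lipschitz_fun (R : realType) (d : nat) (g : 'cV[R]_d -> R) (L : R) : Prop :=
  forall z z', `|g z - g z'| <= L * enorm (z - z').

Definition objective (R : realType) (n d : nat) (f : 'cV[R]_n -> \bar R)
    (A : 'M[R]_(d, n)) (g : 'cV[R]_d -> R) (x : 'cV[R]_n) : \bar R :=
  (f x + (g (A *m x))%:E)%E.

Definition eta (R : realType) (k : nat) : R := 2 / k.+1%:R.

Definition beta (R : realType) (beta0 : R) (k : nat) : R :=
  beta0 / Num.sqrt k.+1%:R.

Definition direction (R : realType) (n d : nat) (f : 'cV[R]_n -> \bar R)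
    (A : 'M[R]_(d, n)) (g : 'cV[R]_d -> R) (b : R) (x : 'cV[R]_n) : 'cV[R]_n :=
  b *: grad f x + A^T *m (A *m x - prox (fun z => b * g z) (A *m x)).

(* The iterates are x 1, x 2, ...; the value x 0 is irrelevant. *)
Definition cg_iterates (R : realType) (n d : nat) (X : set 'cV[R]_n)
    (f : 'cV[R]_n -> \bar R) (A : 'M[R]_(d, n)) (g : 'cV[R]_d -> R)
    (beta0 : R) (x : nat -> 'cV[R]_n) : Prop :=
  X (x 1%N) /\
  forall k, (1 <= k)%N ->
    exists2 s, argmin X (dotv (direction f A g (beta beta0 k) (x k))) s &
               x k.+1 = x k + eta R k *: (s - x k).

(* Main.v *)
Require Import Defs.
From mathcomp Require Import all_boot all_order all_algebra.
From mathcomp Require Import all_classical all_reals all_analysis.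
From mathcomp Require Import ring lra.
Set Implicit Arguments.
Unset Strict Implicit.
Unset Printing Implicit Defensive.
Import Order.TTheory GRing.Theory Num.Theory.
Import numFieldNormedType.Exports.
Local Open Scope classical_set_scope.
Local Open Scope ring_scope.

(** Write [e] for the step size and [b] for the smoothing parameter.  The
    algorithm takes Frank-Wolfe steps on [f + g_b \o A], where [g_b] is the
    Moreau envelope of [g], with a parameter [b] that shrinks along the way.
    The envelope itself is never formed: being the infimum over [u] of
    [moreau_majorant g b u z = g u + |z - u|^2 / (2b)], it is replaced by the
    single majorant whose centre [u] is the proximal point, and what is proved
    for the majorants holds for every centre where an infimum would be needed.

    One step ([cg_step]) combines four facts.  The majorant is a quadratic of
    curvature [1/b] with gradient [(z - p)/b], and [f] satisfies the descent
    lemma, so that [direction / b] is the gradient of an [L + |A|^2/b]-smooth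
    upper model.  The linear minimization oracle makes the linear part of this
    model decrease at least as much as moving towards the reference point [xs]
    does.  Convexity of [f] and the fact that [(z - p)/b] is a subgradient of
    [g] at the proximal point [p] of [z] ([prox_subgradient]) turn that decrease
    into the gap to the value at [xs], with a spare term
    [- e |z - p|^2 / (2b)].  Finally
    [moreau_majorant_prox_le] bounds the loss incurred when the parameter
    shrinks from [b'] to [b] by [(b' - b) |z - p|^2 / (2b^2)]; it is absorbed by
    the spare term as soon as [(1 - e) b' <= b], which [eta_beta_le] checks for
    the schedule at hand.

    Multiplied by [k (k + 1)] the recursion telescopes
    ([surrogate_gap_bound]).  Returning from the majorant to [g] costs at most
    [b Lg^2 / 2] ([lipschitz_le_moreau_majorant]), which gives the first rate;
    the second one is its value at the [beta0] that balances the two terms in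
    [1 / sqrt k]. *)

(** * Euclidean geometry *)

Section Euclid.
Variables (R : realType) (n : nat).
Implicit Types (u v w : 'cV[R]_n) (a : R).

Lemma dotvC u v : dotv u v = dotv v u.
Proof. by apply: eq_bigr => i _; rewrite mulrC. Qed.

Lemma dotvDr u v w : dotv u (v + w) = dotv u v + dotv u w.
Proof. by rewrite -big_split; apply: eq_bigr => i _; rewrite mxE mulrDr. Qed.

Lemma dotvZr a u v : dotv u (a *: v) = a * dotv u v.
Proof. by rewrite mulr_sumr; apply: eq_bigr => i _; rewrite mxE mulrCA. Qed.

Lemma dotvNr u v : dotv u (- v) = - dotv u v.
Proof. by rewrite -scaleN1r dotvZr mulN1r. Qed.

Lemma dotvDl u v w : dotv (u + v) w = dotv u w + dotv v w.
Proof. by rewrite dotvC dotvDr !(dotvC w). Qed.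

Lemma dotvZl a u v : dotv (a *: u) v = a * dotv u v.
Proof. by rewrite dotvC dotvZr dotvC. Qed.

Lemma dotvNl u v : dotv (- u) v = - dotv u v.
Proof. by rewrite dotvC dotvNr dotvC. Qed.

Definition dotvE := (dotvDl, dotvDr, dotvNl, dotvNr, dotvZl, dotvZr).

Lemma dotvv_ge0 u : 0 <= dotv u u.
Proof. by apply: sumr_ge0 => i _; rewrite -expr2 sqr_ge0. Qed.

Lemma enorm_ge0 u : 0 <= enorm u.
Proof. exact: sqrtr_ge0. Qed.

Lemma enorm_sqr u : enorm u ^+ 2 = dotv u u.
Proof. by rewrite sqr_sqrtr ?dotvv_ge0. Qed.

Lemma enormZ a u : enorm (a *: u) = `|a| * enorm u.
Proof.
by rewrite /enorm !dotvE mulrA -expr2 sqrtrM ?sqr_ge0// sqrtr_sqr.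
Qed.

Lemma enormN u : enorm (- u) = enorm u.
Proof. by rewrite /enorm !dotvE opprK. Qed.

Lemma enorm_coord u i : `|u i 0| <= enorm u.
Proof.
rewrite -sqrtr_sqr ler_wsqrtr// /dotv (bigD1 i)//= -expr2 lerDl.
by apply: sumr_ge0 => j _; rewrite -expr2 sqr_ge0.
Qed.

Lemma enorm_eq0 u : enorm u = 0 -> u = 0.
Proof.
move=> u0; apply/colP => i; rewrite mxE; apply/eqP.
by rewrite -normr_le0 -u0 enorm_coord.
Qed.

Lemma enorm0 : enorm (0 : 'cV[R]_n) = 0.
Proof. by rewrite -(scale0r 0) enormZ normr0 mul0r. Qed.

Lemma cauchy_schwarz u v : dotv u v <= enorm u * enorm v.
Proof.
suff : dotv u v ^+ 2 <= (enorm u * enorm v) ^+ 2.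
  have := enorm_ge0 u; have := enorm_ge0 v => v0 u0 h.
  rewrite (le_trans (ler_norm _))// -[leRHS]ger0_norm ?mulr_ge0//.
  by rewrite -ler_sqr ?nnegrE// !real_normK// num_real.
rewrite exprMn !enorm_sqr.
have [u0|] := eqVneq (dotv u u) 0.
  have -> : u = 0 by apply: enorm_eq0; rewrite /enorm u0 sqrtr0.
  rewrite (_ : dotv 0 v = 0) ?expr0n ?mulr_ge0 ?dotvv_ge0//.
  by rewrite -(scale0r 0) dotvZl mul0r.
move=> une0; have upos : 0 < dotv u u by rewrite lt_def une0 dotvv_ge0.
(* This vector is the component of v orthogonal to u, scaled by |u|^2 so that
   no division is needed. *)
have := dotvv_ge0 (dotv u u *: v - dotv u v *: u).
rewrite !dotvE (dotvC v u) => h.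
rewrite -subr_ge0 -(pmulr_rge0 _ upos); apply: le_trans h _.
by rewrite le_eqVlt; apply/orP; left; apply/eqP; ring.
Qed.

Lemma enorm_triangle u v : enorm (u + v) <= enorm u + enorm v.
Proof.
have uv0 : 0 <= enorm u + enorm v by rewrite addr_ge0 ?enorm_ge0.
rewrite -ler_sqr ?nnegrE ?enorm_ge0// enorm_sqr sqrrD !enorm_sqr !dotvE.
have := cauchy_schwarz u v; rewrite (dotvC v u) => h; lra.
Qed.

Lemma enorm_continuous : continuous (@enorm R n).
Proof.
move=> u.
apply: (@continuous_comp _ _ _ (fun w => dotv w w) Num.sqrt); last first.
  exact: sqrt_continuous.
apply: continuous_big => [|i _ w]; first exact: add_continuous.
have wi := @coord_continuous R n 1 i 0 w.
exact: (cvgM wi wi).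
Qed.

End Euclid.

Section Operator.
Variable R : realType.

Lemma dotv_trmx (n d : nat) (A : 'M[R]_(d, n)) (u : 'cV[R]_d) (v : 'cV[R]_n) :
  dotv (A^T *m u) v = dotv u (A *m v).
Proof.
have dotE m (a b : 'cV[R]_m) : dotv a b = (a^T *m b) 0 0.
  by rewrite mxE; apply: eq_bigr => i _; rewrite mxE.
by rewrite !dotE trmx_mul trmxK mulmxA.
Qed.

(** The Frobenius norm of [A] is an upper bound: apply Cauchy-Schwarz to each
    row.  Without an upper bound [sup] would carry no information. *)
Lemma spectral_norm_has_ubound (n d : nat) (A : 'M[R]_(d, n)) :
  has_ubound [set enorm (A *m x) | x in [set x : 'cV[R]_n | enorm x <= 1]].
Proof.
exists (Num.sqrt (\sum_i enorm (row i A)^T ^+ 2)) => _ [x /= x1 <-].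
rewrite ler_wsqrtr//; apply: ler_sum => i _.
have -> : (A *m x) i 0 = dotv (row i A)^T x.
  by rewrite mxE; apply: eq_bigr => j _; rewrite !mxE.
rewrite -expr2 -ler_sqrt ?sqr_ge0// !sqrtr_sqr (ger0_norm (enorm_ge0 _)).
have le (v : 'cV[R]_n) : dotv v x <= enorm v.
  by rewrite (le_trans (cauchy_schwarz _ _))// ler_piMr ?enorm_ge0.
by rewrite ler_norml le andbT lerNl -dotvNl -[leRHS]enormN le.
Qed.

Lemma spectral_norm_ge0 (n d : nat) (A : 'M[R]_(d, n)) : 0 <= spectral_norm A.
Proof.
apply: le_trans (enorm_ge0 _) (ub_le_sup (spectral_norm_has_ubound _) _).
by exists 0; rewrite //= enorm0.
Qed.

Lemma enorm_mulmx (n d : nat) (A : 'M[R]_(d, n)) (x : 'cV[R]_n) :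
  enorm (A *m x) <= spectral_norm A * enorm x.
Proof.
have [x0|xn0] := eqVneq (enorm x) 0.
  by rewrite (enorm_eq0 x0) mulmx0 !enorm0 mulr0.
have xpos : 0 < enorm x by rewrite lt_def xn0 enorm_ge0.
rewrite -ler_pdivrMr// mulrC -[X in X * _]ger0_norm ?invr_ge0 ?enorm_ge0//.
rewrite -enormZ scalemxAr; apply: ub_le_sup.
  exact: spectral_norm_has_ubound.
exists ((enorm x)^-1 *: x) => //=.
by rewrite enormZ ger0_norm ?invr_ge0 ?enorm_ge0// mulVf.
Qed.

Lemma diameter_has_ubound (n : nat) (X : set 'cV[R]_n) : compact X ->
  has_ubound [set enorm (x - y) | x in X & y in X].
Proof.
move=> cX.
have cE : compact [set enorm x | x in X].
  apply: continuous_compact => //; apply: continuous_subspaceT.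
  exact: enorm_continuous.
have [M [_ bM]] := compact_bounded cE.
have XM x : X x -> enorm x <= M + 1.
  move=> Xx; apply: le_trans (ler_norm _) (bM _ _ _ _); first by rewrite ltrDl.
  by exists x.
exists ((M + 1) + (M + 1)) => _ [x Xx [y Xy <-]].
by rewrite (le_trans (enorm_triangle _ _))// enormN lerD ?XM.
Qed.

Lemma le_diameter (n : nat) (X : set 'cV[R]_n) x y : compact X -> X x -> X y ->
  enorm (x - y) <= diameter X.
Proof.
move=> cX Xx Xy; apply: ub_le_sup; first exact: diameter_has_ubound.
by exists x => //; exists y.
Qed.

(** The sign of [L] is not prescribed.  A negative [L] is possible, but then
    the norm inequality defining smoothness forces [X] to be a single point. *)
Lemma smooth_on_diameter_ge0 (n : nat) (X : set 'cV[R]_n) f L :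
  X !=set0 -> compact X -> smooth_on X f L -> 0 <= diameter X ^+ 2 * L.
Proof.
move=> [x0 Xx0] cX smo; case: (lerP 0 L) => [L0|L0].
  by rewrite mulr_ge0// sqr_ge0.
suff -> : diameter X = 0 by rewrite expr0n mul0r.
apply/eqP; rewrite eq_le; apply/andP; split; last first.
  by rewrite (le_trans (enorm_ge0 (x0 - x0)))// le_diameter.
apply: ge_sup; first by exists (enorm (x0 - x0)); exists x0 => //; exists x0.
move=> _ [x Xx [y Xy <-]]; rewrite -(nmulr_rge0 _ L0).
exact: le_trans (enorm_ge0 _) (smo _ _ Xx Xy).
Qed.

End Operator.

(** * Convexity and smoothness *)

Section Convexity.
Variables (R : realType) (n : nat).
Implicit Types (x y : 'cV[R]_n) (t : R).

Lemma convex_set_segment (M : lmodType R) (X : set M) (x y : M) t :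
  convex_set X -> X x -> X y -> 0 <= t <= 1 -> X (x + t *: (y - x)).
Proof.
move=> cX Xx Xy t01.
have [t0 t1] := andP t01; have := cX y x (Itv01 t0 t1).
rewrite !inE => /(_ Xy Xx).
suff -> : conv (Itv01 t0 t1) (y : convex_lmodType M) x = x + t *: (y - x) by [].
by rewrite /conv /= /unstable.onem scalerBl scale1r scalerBr addrCA.
Qed.

Lemma convex_epigraph_le (f : 'cV[R]_n -> \bar R) x y t :
  convex_set (epigraph f) -> f x \is a fin_num -> f y \is a fin_num ->
  0 <= t <= 1 ->
  (f (x + t *: (y - x))%R <= (fine (f x) + t * (fine (f y) - fine (f x)))%:E)%E.
Proof.
move=> cf fx fy t01.
have := @convex_set_segment _ (epigraph f) (x, fine (f x)) (y, fine (f y)) t cf.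
by rewrite /epigraph /= !fineK// !lexx; apply.
Qed.

End Convexity.

Section Differentiable.
Variables (R : realType) (n : nat).
Implicit Types (x y d : 'cV[R]_n) (f : 'cV[R]_n -> \bar R) (t : R).

Lemma derive_grad f x d : ediff f x ->
  'D_d (fine \o f : 'cV[R]_n -> R^o) x = dotv (grad f x) d.
Proof.
move=> [_ df]; rewrite deriveE// {1}(matrix_sum_delta d) linear_sum.
apply: eq_bigr => i _; rewrite linear_sum big_ord1 linearZ mxE deriveE//.
by rewrite mulrC.
Qed.

Lemma is_derive_segment f x d t : ediff f (x + t *: d) ->
  is_derive t 1 (fun s : R => fine (f (x + s *: d)) : R^o)
    (dotv (grad f (x + t *: d)) d).
Proof.
move=> fd; rewrite -derive_grad//.
have := @diff_derivable _ _ _ _ _ d fd.2.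
rewrite /derive /derivable => dv.
pose F : 'cV[R]_n -> R^o := fine \o f.
pose phi (s : R) : R^o := F (x + s *: d).
(* The difference quotients of the restriction to the line and of the
   directional derivative are the same function. *)
have E : (fun h : R => h^-1 *: ((phi \o shift t) (h *: 1) - phi t)) =
    (fun h : R => h^-1 *: ((F \o shift (x + t *: d)) (h *: d) -
                           F (x + t *: d))).
  apply/funext => h /=; congr (_ *: (F _ - _)).
  by rewrite [h *: 1]mulr1 scalerDl addrCA.
by apply: DeriveDef; rewrite /derivable /derive -/phi E.
Qed.

(** Convexity bounds each difference quotient at [x] towards [y] by
    [f y - f x]; the directional derivative is their limit from the right. *)
Lemma gradient_inequality (X : set 'cV[R]_n) f x y :
  convex_set X -> (forall z, X z -> f z \is a fin_num) ->
  convex_set (epigraph f) -> X x -> X y -> ediff f x ->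
  dotv (grad f x) (y - x) <= fine (f y) - fine (f x).
Proof.
move=> cX fX cf Xx Xy fx.
have dx := @diff_derivable _ _ _ _ _ (y - x) fx.2.
rewrite -derive_grad//; apply: (cvgr_to_le (cvg_dnbhs_at_right dx)).
near=> h.
have h0 : 0 < h by [].
have h01 : 0 <= h <= 1 by rewrite (ltW h0)/=; near: h; exact: nbhs_right_le.
rewrite /= -[X in X <= _]/(h^-1 * (fine (f (h *: (y - x) + x)) - fine (f x))).
rewrite (addrC _ x) ler_pdivrMl// lerBlDl -lee_fin fineK.
  by rewrite convex_epigraph_le ?fX.
apply: fX; exact: convex_set_segment.
Unshelve. all: by end_near.
Qed.

(** The gradient is only controlled on [X], so the argument stays on the
    segment from [x] to [y]: along it, [f] minus its quadratic model has a
    nonpositive derivative, by Cauchy-Schwarz and smoothness. *)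
Lemma descent_lemma (X : set 'cV[R]_n) f L x y :
  convex_set X -> (forall z, X z -> ediff f z) -> smooth_on X f L ->
  X x -> X y ->
  fine (f y) <=
    fine (f x) + dotv (grad f x) (y - x) + L / 2 * enorm (y - x) ^+ 2.
Proof.
move=> cX fd smo Xx Xy; set d := y - x.
have Xs (s : R) : 0 <= s <= 1 -> X (x + s *: d) by exact: convex_set_segment.
pose psi (s : R) : R := fine (f (x + s *: d)) - s * dotv (grad f x) d -
  s ^+ 2 * (L / 2 * enorm d ^+ 2).
pose dpsi (s : R) : R := dotv (grad f (x + s *: d) - grad f x) d -
  s * L * enorm d ^+ 2.
have psiD (s : R) : 0 <= s <= 1 -> is_derive s 1 psi (dpsi s).
  move=> s01; have := is_derive_segment (fd _ (Xs _ s01)) => dseg.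
  rewrite /psi; apply: is_derive_eq.
  by rewrite /dpsi dotvDl dotvNl /GRing.scale/=; field.
have [c c01] : exists2 c, c \in `]0, 1[%R & psi 1 - psi 0 = dpsi c * (1 - 0).
  apply: MVT => // [r|].
    by rewrite in_itv/= => /andP[r0 r1]; apply: psiD; rewrite !ltW.
  apply: derivable_within_continuous => r; rewrite in_itv/= => r01.
  by case: (psiD r r01).
move: c01; rewrite in_itv/= => /andP[c0 c1].
suff : dpsi c <= 0.
  rewrite /psi scale1r scale0r addr0 [x + d]addrC subrK => ? ; lra.
rewrite subr_le0 (le_trans (cauchy_schwarz _ _))//.
have Xc : X (x + c *: d) by apply: Xs; rewrite !ltW.
have := smo _ _ Xc Xx.
rewrite (addrC x) addrK enormZ (ger0_norm (ltW c0)) => sm.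
rewrite expr2 [leRHS]mulrA ler_wpM2r ?enorm_ge0//.
by rewrite (le_trans sm)// mulrA (mulrC L).
Qed.

End Differentiable.

(** * The proximal point *)

Section Continuity.
Variables (R : realType) (d : nat).
(* Naming the normed module fixes the structure along which the limits below
   are taken. *)
Let V : normedModType R := 'cV[R]_d.

Lemma enorm_subl_continuous z : continuous (fun w : V => enorm (w - z)).
Proof.
move=> w.
apply: (@continuous_comp V V R^o (fun w => w - z) (@enorm R d)); last first.
  exact: enorm_continuous.
by apply: (@cvgB R V V (nbhs w)); [exact: cvg_id|exact: cvg_cst].
Qed.

Lemma lipschitz_continuous (g : V -> R) L : lipschitz_fun g L -> continuous g.
Proof.
move=> gL z; apply/(@cvgrPdist_le _ _ _ (nbhs z)) => e e0.
near=> w.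
apply: le_trans (gL _ _) _.
apply: le_trans (ler_norm _) _.
rewrite -(opprB w z) enormN -normrN -[- (L * _)]sub0r.
near: w.
have ez := @enorm_subl_continuous z z.
have := cvgMl_tmp (FF := nbhs_filter z) (a := L) ez.
by rewrite subrr enorm0 mulr0 => /cvgr_dist_le/(_ _ e0).
Unshelve. all: by end_near. Qed.

Lemma trmx_continuous : continuous (fun v : 'rV[R]_d => v^T : V).
Proof.
move=> v B /nbhs_ballP[e e0 eB]; apply/nbhs_ballP; exists e => // w [_ vw].
by apply: eB; split=> // i j; rewrite !mxE; exact: vw.
Qed.

Lemma prox_objective_continuous (g : V -> R) L b z : lipschitz_fun g L ->
  continuous (fun u : V => b * g u + 2^-1 * enorm (u - z) ^+ 2).
Proof.
move=> gL u.
have gu := @lipschitz_continuous g L gL u.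
have zu := @enorm_subl_continuous z u.
have FF := nbhs_filter (u : V).
exact: (cvgD (cvgMl_tmp (a := b) gu) (cvgMl_tmp (a := 2^-1) (cvgM zu zu))).
Qed.

End Continuity.

Section Prox.
Variables (R : realType) (d : nat) (g : 'cV[R]_d -> R).
Implicit Types (z p u w : 'cV[R]_d) (b t : R).

(** The proximal objective has a minimizer.  It is at least its value at [z]
    as soon as [|u - z| >= 2 b |L|], since there the quadratic term outweighs the
    decrease of [b g]; a minimizer over a compact box of that half-width around
    [z] is therefore global. *)
Lemma prox_argmin L b z : 0 <= b -> lipschitz_fun g L ->
  argmin setT (fun u => b * g u + 2^-1 * enorm (u - z) ^+ 2)
    (prox (fun u => b * g u) z).
Proof.
move=> b0 gL; apply: getPex; set phi := fun u => _.
pose M := 2 * b * `|L|.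
have phic := @prox_objective_continuous R d g L b z gL.
(* rV_compact is about row vectors, hence the transpositions. *)
pose box := [set v : 'rV[R]_d | forall i, v ord0 i \in `[z i 0 - M, z i 0 + M]].
have cbox : compact box.
  apply: (@rV_compact R d (fun i => `[z i 0 - M, z i 0 + M]%classic)) => i.
  exact: segment_compact.
have M0 : 0 <= M by rewrite !mulr_ge0.
have zbox : box z^T.
  by move=> i; rewrite mxE in_itv/= lerDl lerBlDr lerDl M0.
have [//||c cb cmin] :=
  @compact_EVT_min _ R (fun v : 'rV[R]_d => phi v^T) box _ cbox _.
- by exists z^T.
- apply: continuous_subspaceT => v.
  exact: (@continuous_comp _ _ _ _ phi v (@trmx_continuous R d v) (phic _)).
exists c^T; split=> // u _.
have [ub|/existsNP[i ui]] := pselect (box u^T).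
  by have := cmin u^T; rewrite inE trmxK; apply.
have phiz : phi c^T <= phi z by have := cmin z^T; rewrite inE trmxK; apply.
rewrite (le_trans phiz)// /phi subrr enorm0 expr0n/= mulr0 addr0.
have uM : M <= enorm (u - z).
  rewrite leNgt; apply/negP => uM; apply: ui.
  rewrite mxE in_itv/= -ler_distl.
  have := enorm_coord (u - z) i; rewrite !mxE => /le_trans; apply.
  exact: ltW.
have := gL z u; rewrite -(opprB u z) enormN => /(le_trans (ler_norm _)) gzu.
have : b * (g z - g u) <= b * (`|L| * enorm (u - z)).
  rewrite ler_wpM2l// (le_trans gzu)// ler_wpM2r ?enorm_ge0//.
  exact: ler_norm.
have : M * enorm (u - z) <= enorm (u - z) ^+ 2.
  by rewrite expr2 ler_wpM2r// enorm_ge0.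
rewrite /M; lra.
Qed.

(** First-order optimality: [(z - p)/b] is a subgradient of [g] at [p].
    Comparing [p] with [p + t (u - p)] and using convexity of [g], the defect
    [c] of the inequality is at most [t q] for every [t] in (0, 1], where [q]
    is the contribution of the square. *)
Lemma prox_subgradient b z p : convex_set (epigraph (EFin \o g)) ->
  argmin setT (fun u => b * g u + 2^-1 * enorm (u - z) ^+ 2) p -> 0 < b ->
  forall u, g p + b^-1 * dotv (z - p) (u - p) <= g u.
Proof.
move=> cg [_ pmin] b0 u.
set c := g p - g u + b^-1 * dotv (z - p) (u - p).
suff : c <= 0 by rewrite /c; lra.
set q := dotv (u - p) (u - p) / (2 * b).
have q0 : 0 <= q by rewrite divr_ge0 ?dotvv_ge0 ?mulr_ge0 ?ltW.
have tq t : 0 < t -> t <= 1 -> c <= t * q.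
  move=> t0 t1.
  have /pmin := I : setT (p + t *: (u - p)).
  have := @convex_epigraph_le _ _ (EFin \o g) p u t cg isT isT.
  rewrite (ltW t0) t1 lee_fin/= => /(_ isT) gt.
  have -> : p + t *: (u - p) - z = t *: (u - p) - (z - p).
    by rewrite opprB [RHS]addrCA addrA.
  rewrite -(opprB z p) enormN !enorm_sqr /c /q.
  move: gt; move: (u - p) (z - p) => h w gt; rewrite !dotvE (dotvC h w) => le_h.
  have : b * g (p + t *: h) <= b * (g p + t * (g u - g p)).
    by rewrite ler_pM2l.
  move=> bgt; rewrite -(ler_pM2l (mulr_gt0 t0 b0)).
  have -> : t * b * (g p - g u + b^-1 * dotv w h) =
      t * b * (g p - g u) + t * dotv w h.
    by field; rewrite gt_eqF.
  have -> : t * b * (t * (dotv h h / (2 * b))) = t * t * dotv h h / 2.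
    by field; rewrite gt_eqF.
  lra.
apply/ler_addgt0Pr => e e0; rewrite add0r.
have q1 : 0 < q + 1 by rewrite ltr_wpDl.
(* q may vanish, hence the denominator q + 1. *)
have t0 : 0 < Num.min 1 (e / (q + 1)) by rewrite lt_min ltr01 divr_gt0.
rewrite (le_trans (tq _ t0 _)) ?ge_min ?lexx//.
rewrite (@le_trans _ _ (e / (q + 1) * q))//.
  by rewrite ler_wpM2r// ge_min lexx orbT.
rewrite mulrAC ler_pdivrMr// ler_wpM2l ?ltW//; lra.
Qed.

End Prox.

(** * Majorants of the Moreau envelope *)

(** The Moreau envelope of [g] with parameter [b] is the infimum of these
    functions of [z] over all centres [u], attained at the proximal point. *)
Definition moreau_majorant (R : realType) (d : nat) (g : 'cV[R]_d -> R) (b : R)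
    (u z : 'cV[R]_d) : R := g u + enorm (z - u) ^+ 2 / (2 * b).

Section Majorant.
Variables (R : realType) (d : nat) (g : 'cV[R]_d -> R).
Implicit Types (z p u h : 'cV[R]_d) (b e : R).

(** Maximize [L r - r^2 / (2b)] over [r = |z - u|]: the maximum, at
    [r = b L], is [b L^2 / 2]. *)
Lemma lipschitz_le_moreau_majorant L b u z : lipschitz_fun g L -> 0 < b ->
  g z <= moreau_majorant g b u z + b * L ^+ 2 / 2.
Proof.
move=> gL b0; rewrite /moreau_majorant.
have := le_trans (ler_norm _) (gL z u); set r := enorm _ => gzu.
have : 0 <= (r - b * L) ^+ 2 / (2 * b).
  by rewrite divr_ge0 ?sqr_ge0 ?mulr_ge0 ?ltW.
have -> : (r - b * L) ^+ 2 / (2 * b) =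
    r ^+ 2 / (2 * b) + b * L ^+ 2 / 2 - L * r.
  by field; rewrite gt_eqF.
lra.
Qed.

Lemma moreau_majorant_shift b p z e h : b != 0 ->
  moreau_majorant g b p (z + e *: h) = moreau_majorant g b p z +
    e * (b^-1 * dotv (z - p) h) + e ^+ 2 / 2 * (enorm h ^+ 2 / b).
Proof.
move=> b0; rewrite /moreau_majorant addrAC !enorm_sqr.
move: (z - p) => w; rewrite !dotvE (dotvC h w).
by field.
Qed.

(** Shrinking the smoothing parameter from [b'] to [b] raises the envelope by
    at most [(b' - b)/2] times the squared norm of the subgradient
    [(z - p)/b].  It is enough to have this inequality against the majorant of
    parameter [b'] with an arbitrary centre [u].  By the subgradient inequality
    the difference of the two sides is at least a square, namely
    [|(b'/b) (z - p) - (z - u)|^2 / (2b')]. *)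
Lemma moreau_majorant_prox_le b b' z p u : 0 < b -> 0 < b' ->
  (forall v, g p + b^-1 * dotv (z - p) (v - p) <= g v) ->
  moreau_majorant g b p z <= moreau_majorant g b' u z +
    (b' - b) / (2 * b ^+ 2) * enorm (z - p) ^+ 2.
Proof.
move=> b0 b'0 /(_ u) gu; rewrite /moreau_majorant.
have bn : b != 0 by rewrite gt_eqF.
have b'n : b' != 0 by rewrite gt_eqF.
have := dotvv_ge0 ((b' / b) *: (z - p) - (z - u)).
have E : u - p = (z - p) - (z - u).
  by rewrite opprB [RHS]addrCA addrAC subrr add0r addrC.
move: gu; rewrite {}E !enorm_sqr.
move: (z - p) (z - u) => w k; rewrite !dotvE (dotvC k w).
move=> gu sq.
have i0 : 0 < (2 * b')^-1 by rewrite invr_gt0 mulr_gt0.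
have := mulr_ge0 (ltW i0) sq.
set lhs := (X in 0 <= X).
have -> : lhs = - (b^-1 * (dotv w k - dotv w w)) + dotv k k / (2 * b') +
    (b' - b) / (2 * b ^+ 2) * dotv w w - dotv w w / (2 * b).
  by rewrite /lhs; field; rewrite bn b'n.
lra.
Qed.

End Majorant.

(** * The conditional gradient recursion *)

Section Step.
Variables (R : realType) (n d : nat) (X : set 'cV[R]_n).
Variables (f : 'cV[R]_n -> \bar R) (A : 'M[R]_(d, n)) (g : 'cV[R]_d -> R).
Variables (L Lg : R).
Hypotheses (cX : compact X) (convX : convex_set X).
Hypotheses (convf : convex_set (epigraph f)).
Hypotheses (finf : forall y, X y -> f y \is a fin_num).
Hypotheses (df : forall y, X y -> ediff f y) (smo : smooth_on X f L).
Hypotheses (convg : convex_set (epigraph (EFin \o g))).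
Hypotheses (lipg : lipschitz_fun g Lg).

Lemma smooth_on_le_diameter x y : X x -> X y ->
  L * enorm (x - y) ^+ 2 <= L * diameter X ^+ 2.
Proof.
move=> Xx Xy; have [L0|L0] := lerP 0 L.
  have xyD := le_diameter cX Xx Xy.
  rewrite ler_wpM2l// lerXn2r ?nnegrE ?enorm_ge0//.
  by rewrite (le_trans _ xyD)// enorm_ge0.
have : 0 <= L * enorm (x - y) by exact: le_trans (enorm_ge0 _) (smo Xx Xy).
rewrite nmulr_rge0// => xy0.
have -> : enorm (x - y) = 0 by apply/eqP; rewrite eq_le xy0 enorm_ge0.
rewrite expr0n mulr0 mulrC.
by apply: smooth_on_diameter_ge0 cX smo; exists x.
Qed.

(** The optimality gap relative to [xs], with [g] replaced by one of its
    majorants. *)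
Definition surrogate_gap (xs : 'cV[R]_n) (b : R) (u : 'cV[R]_d)
    (x : 'cV[R]_n) : R :=
  fine (f x) + moreau_majorant g b u (A *m x) - (fine (f xs) + g (A *m xs)).

(** One iteration.  On the right the smoothing parameter [b'] and the centre
    [u] are those left by the previous iteration; on the left they are the
    current ones.  The change is free of charge: by
    [moreau_majorant_prox_le] it costs [(1 - e) (b' - b) |z - p|^2 / (2b^2)],
    while the subgradient inequality leaves [e |z - p|^2 / (2b)] unused, and
    [(1 - e) b' <= b] says that the former is at most the latter. *)
Lemma cg_step b b' e x xs s u : 0 < b -> 0 < b' -> 0 <= e <= 1 ->
  (1 - e) * b' <= b -> X x -> X xs ->
  argmin X (dotv (direction f A g b x)) s ->
  surrogate_gap xs b (prox (fun z => b * g z) (A *m x)) (x + e *: (s - x)) <=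
  (1 - e) * surrogate_gap xs b' u x +
  e ^+ 2 / 2 * (diameter X ^+ 2 * (L + spectral_norm A ^+ 2 / b)).
Proof.
move=> b0 b'0 e01 eb Xx Xxs [Xs smin].
have bn : b != 0 by rewrite gt_eqF.
have e0 : 0 <= e by case/andP: e01.
have e1 : 0 <= 1 - e by rewrite subr_ge0; case/andP: e01.
have sub := prox_subgradient convg (prox_argmin (A *m x) (ltW b0) lipg) b0.
have := smin _ Xxs; rewrite /direction /surrogate_gap {smin}.
move: (prox _ _) sub => p sub opt; set y := x + _.
have Xy : X y by exact: convex_set_segment.
have desc := descent_lemma convX df smo Xx Xy.
have yx : y - x = e *: (s - x) by rewrite /y addrAC subrr add0r.
rewrite {}yx dotvZr enormZ exprMn real_normK ?num_real// in desc.
have -> : A *m y = A *m x + e *: (A *m (s - x)) by rewrite mulmxDr scalemxAr.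
rewrite moreau_majorant_shift//.
have dec := moreau_majorant_prox_le u b0 b'0 sub.
have subs := sub (A *m xs).
have Axs : A *m xs - p = A *m (xs - x) + (A *m x - p).
  by rewrite mulmxBr addrA subrK.
rewrite {}Axs dotvDr -enorm_sqr in subs.
have grad_le := gradient_inequality convX finf convf Xx Xxs (df Xx).
rewrite !dotvDl !dotvZl !dotv_trmx in opt.
have {}opt : b * dotv (grad f x) (s - x) + dotv (A *m x - p) (A *m (s - x)) <=
    b * dotv (grad f x) (xs - x) + dotv (A *m x - p) (A *m (xs - x)).
  by move: opt; rewrite !mulmxBr; move: (A *m x - p) => w; rewrite !dotvE; lra.
have Lsx := smooth_on_le_diameter Xs Xx.
have Asx : enorm (A *m (s - x)) ^+ 2 <= diameter X ^+ 2 * spectral_norm A ^+ 2.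
  have AD : enorm (A *m (s - x)) <= spectral_norm A * diameter X.
    rewrite (le_trans (enorm_mulmx _ _))// ler_wpM2l ?spectral_norm_ge0//.
    exact: le_diameter.
  rewrite mulrC -exprMn ler_sqr ?nnegrE ?enorm_ge0//.
  by rewrite (le_trans _ AD)// enorm_ge0.
(* What remains is an inequality between real numbers: the hypotheses are
   scaled by their nonnegative weights and added up. *)
have ww0 := sqr_ge0 (enorm (A *m x - p)).
move: desc dec subs grad_le opt Lsx Asx ww0; rewrite {1 3}/moreau_majorant.
move: (fine (f x)) (fine (f y)) (fine (f xs)) => gx gy gxs.
move: (dotv _ (s - x)) (dotv _ (xs - x)) => G Gs.
move: (dotv _ (A *m (s - x))) (dotv _ (A *m (xs - x))) => W Ws.
move: (enorm (A *m x - p) ^+ 2) => ww.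
move: (enorm (s - x) ^+ 2) (enorm (A *m (s - x)) ^+ 2) => q r.
move: (diameter X ^+ 2) (spectral_norm A ^+ 2) => D2 a2.
move: (moreau_majorant g b' _ _) (g p) (g (A *m xs)) => M' gp gA.
move=> desc dec subs grad_le opt Lsx Asx ww0.
have i0 : 0 <= b^-1 by rewrite invr_ge0 ltW.
have bb : b * b^-1 = 1 by rewrite mulfV.
have halfE c : c / (2 * b) = c * b^-1 / 2 by field.
have sqE : (b' - b) / (2 * b ^+ 2) = (b' - b) * b^-1 * b^-1 / 2 by field.
rewrite halfE sqE in dec; rewrite halfE.
move: (b^-1) i0 bb {halfE sqE} dec subs => i i0 bb dec subs.
have opt' : e * (G + i * W) <= e * (Gs + i * Ws).
  rewrite ler_wpM2l//; have := ler_wpM2l i0 opt.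
  by rewrite !mulrDr !mulrA (mulrC i) bb !mul1r.
have grad' := ler_wpM2l e0 grad_le.
have subs' := ler_wpM2l e0 subs.
have dec' := ler_wpM2l e1 dec.
have wi0 : 0 <= ww * i * i / 2 by rewrite !mulr_ge0.
have eb' : (1 - e) * (b' - b) <= e * b by lra.
have := ler_wpM2l wi0 eb'.
have -> : ww * i * i / 2 * (e * b) = ww * i / 2 * e * (b * i) by ring.
rewrite bb mulr1 => key.
have e2 : 0 <= e ^+ 2 / 2 by rewrite divr_ge0// sqr_ge0.
have Lsx' := ler_wpM2l e2 Lsx.
have Asx' := ler_wpM2l e2 (ler_wpM2l i0 Asx).
lra.
Qed.

Variables (beta0 : R) (xs : 'cV[R]_n) (x : nat -> 'cV[R]_n).
Hypotheses (beta0_gt0 : 0 < beta0) (Xxs : X xs).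
Hypothesis (iter : cg_iterates X f A g beta0 x).

Lemma eta_itv k : (1 <= k)%N -> 0 <= eta R k <= 1.
Proof.
move=> k1; rewrite /eta divr_ge0//= ler_pdivrMr ?ltr0Sn// mul1r.
by rewrite (ler_nat _ 2).
Qed.

Lemma beta_gt0 k : 0 < beta beta0 k.
Proof. by rewrite divr_gt0// sqrtr_gt0 ltr0Sn. Qed.

Lemma cg_iterates_mem k : (1 <= k)%N -> X (x k).
Proof.
case: iter => X1 step; elim: k => // -[//|k] IH _.
have [s [Xs _] ->] := step k.+1 isT.
by apply: convex_set_segment => //; [exact: IH|exact: eta_itv].
Qed.

(** With [p = sqrt (k + 1)] and [q = sqrt (k + 2)], so that [q^2 = p^2 + 1],
    this amounts to [p^2 - 1 <= p q], which follows from [p <= q]. *)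
Lemma eta_beta_le k : (1 - eta R k.+1) * beta beta0 k <= beta beta0 k.+1.
Proof.
rewrite /beta /eta.
have p0 : 0 < Num.sqrt (k.+1%:R : R) by rewrite sqrtr_gt0 ltr0Sn.
have q0 : 0 < Num.sqrt (k.+2%:R : R) by rewrite sqrtr_gt0 ltr0Sn.
have pq : Num.sqrt (k.+1%:R : R) <= Num.sqrt (k.+2%:R).
  by rewrite ler_wsqrtr// ler_nat.
have q2 : (k.+2%:R : R) = Num.sqrt (k.+2%:R) ^+ 2 by rewrite sqr_sqrtr.
have q2p2 : Num.sqrt (k.+2%:R : R) ^+ 2 = Num.sqrt (k.+1%:R) ^+ 2 + 1.
  by rewrite !sqr_sqrtr// -natr1.
rewrite [X in 2 / X]q2; move: q2p2 pq p0 q0 {q2}.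
move: (Num.sqrt _) (Num.sqrt _) => p q q2p2 pq p0 q0.
rewrite ler_pdivlMr// mulrA mulrAC ler_pdivrMr// -(ler_pM2l q0).
have -> : q * ((1 - 2 / q ^+ 2) * beta0 * q) = (q ^+ 2 - 2) * beta0.
  by field; rewrite gt_eqF.
have : beta0 * (p * p) <= beta0 * (q * p) by rewrite !ler_pM2l// ler_pM2r.
rewrite q2p2; move: beta0_gt0; lra.
Qed.

(* The majorant at x_(k+1) is still the one built at x_k.  At k = 0 its centre
   comes from the meaningless x 0; the factor k below makes this harmless. *)
Let gap k := surrogate_gap xs (beta beta0 k)
  (prox (fun z => beta beta0 k * g z) (A *m x k)) (x k.+1).

(** Multiplied by [(k + 2) (k + 1)], the recursion of [cg_step] with
    [e = 2 / (k + 2)] telescopes, and each step adds at most [2 B], where [B]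
    is the last factor of the bound, which grows with [k]. *)
Lemma surrogate_gap_bound k :
  k.+1%:R * k%:R * gap k <= 2 * k%:R * (diameter X ^+ 2 *
    (L + spectral_norm A ^+ 2 * Num.sqrt k.+1%:R / beta0)).
Proof.
have DL : 0 <= diameter X ^+ 2 * L.
  by apply: smooth_on_diameter_ge0 cX smo; exists xs.
elim: k => [|k IH]; first by rewrite !(mulr0n, mulr0, mul0r).
have [s sarg xE] := iter.2 k.+1 isT.
have := cg_step (prox (fun z => beta beta0 k * g z) (A *m x k))
  (beta_gt0 k.+1) (beta_gt0 k) (eta_itv (ltn0Sn k)) (eta_beta_le k)
  (cg_iterates_mem (ltn0Sn k)) Xxs sarg.
rewrite -xE -/(gap k.+1) -/(gap k).
have pq : Num.sqrt (k.+1%:R : R) <= Num.sqrt (k.+2%:R).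
  by rewrite ler_wsqrtr// ler_nat.
have -> : spectral_norm A ^+ 2 / beta beta0 k.+1 =
    spectral_norm A ^+ 2 * Num.sqrt k.+2%:R / beta0 by rewrite invf_div mulrA.
move: IH; rewrite /eta.
set B := _ * (L + _ * Num.sqrt k.+1%:R / _).
set B' := _ * (L + _ * Num.sqrt k.+2%:R / _).
have BB' : B <= B'.
  rewrite /B /B' ler_wpM2l ?sqr_ge0// lerD2l ler_pM2r ?invr_gt0//.
  by rewrite ler_wpM2l ?sqr_ge0.
have B'0 : 0 <= B'.
  rewrite /B' mulrDr addr_ge0// mulr_ge0 ?sqr_ge0// divr_ge0 ?(ltW beta0_gt0)//.
  by rewrite mulr_ge0 ?sqr_ge0 ?sqrtr_ge0.
rewrite -(natr1 k.+1) -(natr1 k); have := ler0n R k.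
move: (k%:R) => K K0 IH step.
have K2 : 0 < K + 1 + 1 by lra.
have K12 : 0 < (K + 1 + 1) * (K + 1) by rewrite mulr_gt0//; lra.
have := ler_wpM2l (ltW K12) step.
have -> : (K + 1 + 1) * (K + 1) *
    ((1 - 2 / (K + 1 + 1)) * gap k + (2 / (K + 1 + 1)) ^+ 2 / 2 * B') =
    (K + 1) * K * gap k + 2 * B' - 2 * B' / (K + 1 + 1).
  by field; rewrite gt_eqF.
have : 0 <= 2 * B' / (K + 1 + 1).
  by apply: divr_ge0; [rewrite mulr_ge0|exact: ltW].
have : 2 * K * B <= 2 * K * B' by rewrite ler_wpM2l// mulr_ge0.
lra.
Qed.

Lemma cg_primal_gap k : (2 <= k)%N ->
  (objective f A g (x k) - objective f A g xs <=
     (2 * diameter X ^+ 2 *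
        (L / k%:R + spectral_norm A ^+ 2 / (beta0 * Num.sqrt k%:R)) +
      beta0 * Lg ^+ 2 / (2 * Num.sqrt k%:R))%:E)%E.
Proof.
case: k => [//|[//|k]] _.
have Xk := @cg_iterates_mem k.+2 isT.
rewrite /objective -(fineK (finf Xk)) -(fineK (finf Xxs)) -!EFinD lee_fin.
have := surrogate_gap_bound k.+1.
have := lipschitz_le_moreau_majorant
  (prox (fun z => beta beta0 k.+1 * g z) (A *m x k.+1)) (A *m x k.+2)
  lipg (beta_gt0 k.+1).
rewrite /gap /surrogate_gap /beta.
move: (moreau_majorant _ _ _ _) (fine _) (fine _) => M Fs F.
have p0 : 0 < Num.sqrt (k.+2%:R : R) by rewrite sqrtr_gt0 ltr0Sn.
have pp : (k.+2%:R : R) = Num.sqrt (k.+2%:R) ^+ 2 by rewrite sqr_sqrtr.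
have k1 : 0 < (k.+1%:R : R) by rewrite ltr0Sn.
have b0 : beta0 != 0 by rewrite gt_eqF.
move: (Num.sqrt k.+2%:R) p0 pp (k.+1%:R) k1 => p p0 -> K K0 gM.
set D := diameter X; set a := spectral_norm A.
have -> : 2 * K * (D ^+ 2 * (L + a ^+ 2 * p / beta0)) =
    p ^+ 2 * K * (2 * D ^+ 2 * (L / p ^+ 2 + a ^+ 2 / (beta0 * p))).
  by field; rewrite b0 gt_eqF.
rewrite ler_pM2l ?mulr_gt0 ?exprn_gt0//.
have -> : beta0 * Lg ^+ 2 / (2 * p) = beta0 / p * Lg ^+ 2 / 2.
  by field; rewrite gt_eqF.
lra.
Qed.

End Step.

(** * The two rates *)

Theorem theorem3p2 (R : realType) (n d : nat) (X : set 'cV[R]_n)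
    (f : 'cV[R]_n -> \bar R) (A : 'M[R]_(d, n)) (g : 'cV[R]_d -> R)
    (Lf Lg beta0 : R) (xstar : 'cV[R]_n) (x : nat -> 'cV[R]_n) :
  X !=set0 -> compact X -> convex_set X ->
  proper_fun f -> closed_convex f ->
  (forall y, X y -> f y \is a fin_num) ->
  (forall y, X y -> ediff f y) -> smooth_on X f Lf ->
  closed_convex (EFin \o g) -> lipschitz_fun g Lg ->
  argmin X (objective f A g) xstar ->
  0 < beta0 ->
  cg_iterates X f A g beta0 x ->
  (forall k : nat, (2 <= k)%N ->
    (objective f A g (x k) - objective f A g xstar <=
      (2 * diameter X ^+ 2 *
         (Lf / k%:R + spectral_norm A ^+ 2 / (beta0 * Num.sqrt k%:R)) +
       beta0 * Lg ^+ 2 / (2 * Num.sqrt k%:R))%:E)%E) /\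
  (Lg != 0 -> beta0 = 2 * diameter X * spectral_norm A / Lg ->
   forall k : nat, (2 <= k)%N ->
    (objective f A g (x k) - objective f A g xstar <=
      (2 * diameter X ^+ 2 * Lf / k%:R +
       2 * diameter X * spectral_norm A * Lg / Num.sqrt k%:R)%:E)%E).
Proof.
move=> _ cX convX _ [_ convf] finf df smo [_ convg] lipg [Xxs _] b0 iter.
have bound := cg_primal_gap cX convX convf finf df smo convg lipg b0 Xxs iter.
split=> // Lg0 bE k k2; apply: le_trans (bound k k2) _; rewrite lee_fin.
have b0n : beta0 != 0 by rewrite gt_eqF.
have k0 : k%:R != 0 :> R by rewrite pnatr_eq0 -lt0n ltnW.
have p0 : Num.sqrt (k%:R : R) != 0.
  by rewrite gt_eqF// sqrtr_gt0 lt_def k0 ler0n.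
(* For this beta0 the terms in 1 / sqrt k, 2 (D a)^2 / beta0 and
   beta0 Lg^2 / 2, are equal. *)
have Da : 2 * (diameter X * spectral_norm A) = beta0 * Lg.
  by rewrite bE mulfVK// mulrA.
move: (diameter X) (spectral_norm A) (Num.sqrt k%:R) p0 Da => D a p p0 Da.
have -> : 2 * D ^+ 2 * (Lf / k%:R + a ^+ 2 / (beta0 * p)) +
    beta0 * Lg ^+ 2 / (2 * p) = 2 * D ^+ 2 * Lf / k%:R +
    ((2 * (D * a)) ^+ 2 / beta0 + beta0 * Lg ^+ 2) / (2 * p).
  by field; rewrite k0 b0n p0.
rewrite -(mulrA 2 D a) Da lerD2l le_eqVlt; apply/orP; left; apply/eqP.
by field; rewrite b0n p0.
Qed.
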